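(* Let $\delta\in\mathbb{C}$, let $p$ be a non-negative integer, and let $n_1,n_2$ be integers with $0\le n_1<n_2$. Then $$\sum_{k=n_1}^{n_2-1}k^pe^{\delta k}=\begin{cases}\displaystyle\sum_{\ell=0}^{p}\frac{\chi_{n_1}(p,\ell)\,e^{(n_1+\ell)\delta}-\chi_{n_2}(p,\ell)\,e^{(n_2+\ell)\delta}}{(1-e^\delta)^{\ell+1}}, & e^\delta\ne1;\\[2ex]\displaystyle\frac{B_{p+1}(n_2)-B_{p+1}(n_1)}{p+1}, & e^\delta=1,\end{cases}$$ where $B_p$ is the $p$th Bernoulli polynomial and the coefficients $\chi_n(p,\ell)$ are given, for integers $n,p,\ell\ge0$, by the recurrence $$\chi_n(p+1,\ell)=(n+\ell)\,\chi_n(p,\ell)+\ell\,\chi_n(p,\ell-1),\qquad \chi_n(0,\ell)=\delta_{\ell,0}.$$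
   Context: Here $\delta_{\ell,0}$ is the Kronecker delta (equal to $1$ if $\ell=0$ and $0$ otherwise), not to be confused with the complex number $\delta$. The term $\ell\,\chi_n(p,\ell-1)$ is taken to be $0$ when $\ell=0$. The convention $0^0=1$ is used for $k^p$. *)

(* Defs.v *)
From HB Require Import structures.
From mathcomp Require Import all_boot all_order all_algebra.
From mathcomp Require Import complex.
From mathcomp Require Import reals sequences exp trigo.

Set Implicit Arguments.
Unset Strict Implicit.
Unset Printing Implicit Defensive.

Import Order.TTheory GRing.Theory Num.Theory.
Local Open Scope ring_scope.
Local Open Scope complex_scope.

Definition cexp (R : realType) (z : R[i]) : R[i] :=
  (expR (complex.Re z))%:C * (cos (complex.Im z) +i* sin (complex.Im z)).

(* At l = 0 the second summand vanishes because of its factor l, so the value *)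
(* of l.-1 is irrelevant there.                                               *)
Fixpoint chi (n p l : nat) : nat :=
  if p is q.+1 then ((n + l) * chi n q l + l * chi n q l.-1)%N
  else (l == 0)%N.

(* The Bernoulli polynomials are given by the generating function             *)
(*   t e^(xt) / (e^t - 1) = \sum_n B_n(x) t^n / n!.                           *)
(* Comparing the coefficients of t^(n+1) / (n+1)! in                          *)
(*   (e^t - 1) \sum_n B_n(x) t^n / n! = t e^(xt)                              *)
(* gives \sum_(k <= n) 'C(n+1, k) B_k(x) = (n+1) x^n, which is solved for B_n *)
(* below (see bernoulli_polyE).                                               *)
(* bernoulli_polys n is the sequence B_0, ..., B_(n-1).                       *)
Fixpoint bernoulli_polys (F : numFieldType) (n : nat) : seq {poly F} :=
  if n is m.+1 then
    let s := bernoulli_polys F m in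
    rcons s ('X^m - m.+1%:R^-1 *: \sum_(k < m) 'C(m.+1, k)%:R *: s`_k)
  else [::].

Definition bernoulli_poly (F : numFieldType) (n : nat) : {poly F} :=
  (bernoulli_polys F n.+1)`_n.

Lemma size_bernoulli_polys (F : numFieldType) n :
  size (bernoulli_polys F n) = n.
Proof. by elim: n => //= n IHn; rewrite size_rcons IHn. Qed.

Lemma nth_bernoulli_polys (F : numFieldType) n k : (k < n)%N ->
  (bernoulli_polys F n)`_k = bernoulli_poly F k.
Proof.
elim: n => // n IHn; rewrite ltnS leq_eqVlt => /predU1P[-> //|ltkn].
by rewrite /= nth_rcons size_bernoulli_polys ltkn IHn.
Qed.

Lemma bernoulli_polyE (F : numFieldType) n :
  \sum_(k < n.+1) 'C(n.+1, k)%:R *: bernoulli_poly F k = n.+1%:R *: 'X^n.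
Proof.
rewrite big_ord_recr /= binSn {2}/bernoulli_poly /= nth_rcons.
rewrite size_bernoulli_polys ltnn eqxx scalerBr scalerA divff ?pnatr_eq0 //.
rewrite scale1r addrC -addrA -[RHS]addr0; congr (_ + _).
apply/eqP; rewrite addrC subr_eq0; apply/eqP/eq_bigr => k _.
by rewrite nth_bernoulli_polys.
Qed.

(* Main.v *)
Require Import Defs.
From mathcomp Require Import all_boot all_order all_algebra.
From mathcomp Require Import complex.
From mathcomp Require Import reals.
From mathcomp Require Import sequences exp trigo.
From mathcomp Require Import ring.

Import GRing.Theory.
Local Open Scope ring_scope.
Local Open Scope complex_scope.

(** Both cases are telescoping arguments: a sequence whose difference at [n]
    is [n ^ p * q ^ n], with [q = cexp delta], is exhibited, and the sum is
    the difference of its values at [n2] and [n1].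

    When [q != 1], the point is that [chi n p l] is the [l]-th forward
    difference of [x ^ p] at [x = n]: it equals [n ^ p] at [l = 0] ([chi0]),
    vanishes for [l > p] ([chi_gt]), and satisfies
    [chi n.+1 p l = chi n p l + chi n p l.+1] ([chiS]).  Substituting the last
    relation into the difference of the formula at [n] and [n.+1] makes the sum
    over [l] telescope in turn, and only its boundary terms, namely
    [n ^ p * q ^ n] at [l = 0] and [0] at [l = p.+1], survive
    ([chi_geom_diff]).

    When [q = 1], the summand is [k ^ p], and the sequence is provided by
    [B_(p+1)(x + 1) - B_(p+1)(x) = (p + 1) x ^ p] ([bernoulli_poly_diff]),
    which follows from the recurrence of the Bernoulli polynomials by strong
    induction. *)

Lemma cexp0 (R : realType) : cexp (0 : R[i]) = 1.
Proof. by rewrite /cexp /= expR0 cos0 sin0 mul1r. Qed.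

Lemma cexpD (R : realType) (a b : R[i]) : cexp (a + b) = cexp a * cexp b.
Proof.
case: a b => [a1 a2] [b1 b2]; rewrite /cexp /= expRD cosD sinD.
by apply/eqP; rewrite eq_complex /=; apply/andP; split; apply/eqP; ring.
Qed.

Lemma cexpMn (R : realType) (n : nat) (z : R[i]) :
  cexp (n%:R * z) = cexp z ^+ n.
Proof.
elim: n => [|n IHn]; first by rewrite mul0r cexp0 expr0.
by rewrite -natr1 mulrDl mul1r cexpD IHn exprSr.
Qed.

Lemma chi0 (n p : nat) : chi n p 0 = (n ^ p)%N.
Proof. by elim: p => //= p ->; rewrite addn0 mul0n addn0 expnS. Qed.

Lemma chi_gt (n p l : nat) : (p < l)%N -> chi n p l = 0%N.
Proof.
elim: p l => [|p IHp] [|l] //= lt_pl.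
by rewrite !IHp ?muln0 //; apply: ltnW.
Qed.

(** Pascal's rule for forward differences: shifting the base point by one is
    the identity plus the difference operator. *)
Lemma chiS (n p l : nat) : chi n.+1 p l = (chi n p l + chi n p l.+1)%N.
Proof.
elim: p l => [|p IHp] l /=; first by rewrite addn0.
case: l => [|l] /=; rewrite !IHp; ring.
Qed.

(** Over the complex numbers with [`|q| < 1], the sum over [l] attached to [n]
    is the tail [\sum_(k >= n) k ^ p * q ^ k], whence the right-hand side; as
    an identity of rational functions of [q], it holds in any field. *)
Lemma chi_geom_diff (F : fieldType) (q : F) (n p : nat) : q != 1 ->
  \sum_(0 <= l < p.+1)
    ((chi n p l)%:R * q ^+ (n + l) - (chi n.+1 p l)%:R * q ^+ (n.+1 + l))
      / (1 - q) ^+ l.+1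
  = n%:R ^+ p * q ^+ n.
Proof.
move=> q_neq1; have q1 : 1 - q != 0 by rewrite subr_eq0 eq_sym.
pose u l := - ((chi n p l)%:R * q ^+ (n + l) / (1 - q) ^+ l).
rewrite (eq_bigr (fun l => u l.+1 - u l)); last first.
  move=> l _; rewrite /u chiS natrD addSn addnS !exprS.
  by field; rewrite q1 expf_neq0.
rewrite telescope_sumr // /u chi_gt // chi0 addn0 natrX.
by rewrite !mul0r oppr0 sub0r opprK expr0 divr1.
Qed.

(** The differences [B_k(x + 1) - B_k(x)] and the numbers [k x ^ (k - 1)]
    satisfy the same triangular recurrence: the recurrence of the [B_k] gives
    [(n + 1) ((x + 1) ^ n - x ^ n)] on the right, and so do the latter by the
    absorption [k 'C(n+1, k) = (n + 1) 'C(n, k-1)] and the binomial theorem. *)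
Lemma bernoulli_poly_diff (F : numFieldType) (x : F) (n : nat) :
  (bernoulli_poly F n).[x + 1] - (bernoulli_poly F n).[x] = n%:R * x ^+ n.-1.
Proof.
elim/ltn_ind: n => n IHn.
pose d k := (bernoulli_poly F k).[x + 1] - (bernoulli_poly F k).[x].
have sum_d : \sum_(k < n.+1) 'C(n.+1, k)%:R * d k
             = n.+1%:R * ((x + 1) ^+ n - x ^+ n).
  have ev y : \sum_(k < n.+1) 'C(n.+1, k)%:R * (bernoulli_poly F k).[y]
              = n.+1%:R * y ^+ n.
    have := congr1 (horner^~ y) (bernoulli_polyE F n).
    rewrite horner_sum hornerZ hornerXn => <-.
    by apply: eq_bigr => k _; rewrite hornerZ.
  rewrite mulrBr -!ev -sumrB; apply: eq_bigr => k _.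
  by rewrite mulrBr.
have sum_pow : \sum_(k < n.+1) 'C(n.+1, k)%:R * (k%:R * x ^+ k.-1)
               = n.+1%:R * ((x + 1) ^+ n - x ^+ n).
  rewrite big_ord_recl mul0r mulr0 add0r [x + 1]addrC exprDn.
  rewrite big_ord_recr /= subnn expr0 mul1r binn mulr1n addrK mulr_sumr.
  apply: eq_bigr => k _; rewrite expr1n mul1r /bump /= add1n add0n.
  rewrite -[x ^+ k *+ _]mulr_natl !mulrA -!natrM; congr (_%:R * _).
  by rewrite mulnC -mul_bin_diag.
(* The terms of index below n agree by induction, hence so do the last ones. *)
move: sum_d; rewrite -sum_pow !big_ord_recr /=.
rewrite (eq_bigr (fun k : 'I_n => 'C(n.+1, k)%:R * (k%:R * x ^+ k.-1)));
  last by move=> k _; rewrite /d IHn.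
by move/addrI/mulfI; apply; rewrite binSn Num.Theory.pnatr_eq0.
Qed.

Theorem theoremB2 (R : realType) (delta : R[i]) (p n1 n2 : nat) (hn : (n1 < n2)%N) :
  \sum_(n1 <= k < n2) k%:R ^+ p * cexp (delta * k%:R) =
  if cexp delta != 1 then
    \sum_(0 <= l < p.+1)
      ((chi n1 p l)%:R * cexp ((n1 + l)%:R * delta)
       - (chi n2 p l)%:R * cexp ((n2 + l)%:R * delta))
      / (1 - cexp delta) ^+ l.+1
  else
    ((bernoulli_poly R[i] p.+1).[n2%:R] - (bernoulli_poly R[i] p.+1).[n1%:R])
      / p.+1%:R.
Proof.
set q := cexp delta; have le_n := ltnW hn.
rewrite (eq_bigr (fun k => k%:R ^+ p * q ^+ k)); last first.
  by move=> k _; rewrite mulrC [delta * _]mulrC cexpMn mulrC.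
case: ifPn => [q_neq1 | /negPn/eqP q1].
- pose S n := - \sum_(0 <= l < p.+1)
    (chi n p l)%:R * q ^+ (n + l) / (1 - q) ^+ l.+1.
  rewrite (eq_bigr (fun k => S k.+1 - S k)); last first.
    move=> k _; rewrite -(chi_geom_diff _ _ k p q_neq1) /S opprK.
    rewrite [RHS]addrC -sumrB.
    by apply: eq_bigr => l _; rewrite mulrBl.
  rewrite telescope_sumr // /S opprK [LHS]addrC -sumrB.
  by apply: eq_bigr => l _; rewrite !cexpMn mulrBl.
- rewrite -(telescope_sumr (fun k => (bernoulli_poly R[i] p.+1).[k%:R]) le_n).
  rewrite mulr_suml; apply: eq_bigr => k _.
  rewrite -natr1 bernoulli_poly_diff q1 expr1n mulr1 mulrC mulKf //.
  by rewrite Num.Theory.pnatr_eq0.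
Qed.
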